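(* Let $(a_n)_{n\ge 1}$ be a sequence of quaternions with $|a_n|<1$ for all $n\ge 1$, and suppose that all $a_n$ lie on the same slice, i.e. there exists $I\in\mathbb{S}$ such that for every $n\ge 1$, $a_n=r_ne^{\theta_n I}=r_n(\cos\theta_n+I\sin\theta_n)$ with $r_n=|a_n|<1$ and $\theta_n\in\mathbb{R}$. Let $(\mathbf{\Phi}_n)_{n\ge1}$ be the slice regular Malmquist–Takenaka system generated by $(a_n)_{n\ge1}$, and for $n\ge1$ and $f\in H^2(\mathbb{B})$ put $$P_nf(z)=\sum_{k=1}^n\mathbf{\Phi}_k(z)\,\langle f,\mathbf{\Phi}_k\rangle .$$ Then for all $n\ge1$ and all $f\in H^2(\mathbb{B})$ the restriction of $P_nf$ to the slice $\mathbb{B}_I$ interpolates $f$ at the points $a_1,\dots,a_n$; that is, $P_nf(a_\ell)=f(a_\ell)$ for every $\ell\in\{1,\dots,n\}$.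
   Context: $\mathbb{H}$ is the skew field of quaternions with norm $|q|=\sqrt{q\overline q}$, $\mathbb{B}=\{q\in\mathbb{H}:|q|<1\}$, and $\mathbb{S}=\{q\in\mathbb{H}:q^2=-1\}$ is the sphere of imaginary units. For $I\in\mathbb{S}$, $L_I=\mathbb{R}+\mathbb{R}I$ and $\mathbb{B}_I=\mathbb{B}\cap L_I$. Slice regular functions: a function $f:\mathbb{B}\to\mathbb{H}$ is (slice) regular if for every $I\in\mathbb{S}$ its restriction $f_I$ to $\mathbb{B}_I$ has continuous partial derivatives and satisfies $\frac12\left(\frac{\partial}{\partial x}+I\frac{\partial}{\partial y}\right)f_I(x+yI)=0$; equivalently, $f(q)=\sum_{n\ge 0}q^na_n$ is a power series with coefficients $a_n\in\mathbb{H}$ converging on $\mathbb{B}$ (similarly on larger balls centered at $0$). For regular $f(q)=\sum q^na_n$, $g(q)=\sum q^nb_n$: - regular product: $(f\ast g)(q)=\sum_{n\ge 0}q^n\sum_{k=0}^na_kb_{n-k}$ (associative, generally non-commutative); - regular conjugate: $f^c(q)=\sum_{n\ge 0}q^n\overline{a_n}$; symmetrization: $f^s=f\ast f^c=f^c\ast f$; - regular reciprocal: $f^{-\ast}=(f^s)^{-1}f^c$ (where $f^s\neq 0$). For $a\in\mathbb{B}$ the regular Blaschke function is $\mathcal{B}_a(q)=(1-q\overline a)^{-\ast}\ast(q-a)$. Hardy space: $H^2(\mathbb{B})$ is the space of regular $f:\mathbb{B}\to\mathbb{H}$, $f(q)=\sum_{n\ge0}q^na_n$, with $\sum_{n\ge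 0}|a_n|^2<\infty$, with inner product, for $g(q)=\sum_{n\ge 0} q^nb_n$, $$\langle f,g\rangle=\sum_{n\ge 0}\overline{b_n}a_n=\lim_{r\to1^-}\frac1{2\pi}\int_0^{2\pi}\overline{g(re^{I\theta})}f(re^{I\theta})\,d\theta\quad\text{for any } I\in\mathbb{S}.$$ Slice regular Malmquist–Takenaka system generated by a sequence $(a_n)_{n\ge1}$ in $\mathbb{B}$: $$\mathbf{\Phi}_1(z)=\sqrt{1-|a_1|^2}\,(1-z\overline{a_1})^{-\ast},$$ $$\mathbf{\Phi}_n(z)=\sqrt{1-|a_n|^2}\,\bigl(\mathcal{B}_{a_1}\ast\mathcal{B}_{a_2}\ast\cdots\ast\mathcal{B}_{a_{n-1}}\bigr)(z)\ast(1-z\overline{a_n})^{-\ast}\quad(n\ge2).$$ *)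

(* Defs.v *)
From HB Require Import structures.
From mathcomp Require Import all_boot all_order all_algebra.
From mathcomp Require Import all_classical all_reals all_analysis.
From mathcomp Require Import ring lra.

Set Implicit Arguments.
Unset Strict Implicit.
Unset Printing Implicit Defensive.

Import Order.TTheory GRing.Theory Num.Theory.
Import numFieldNormedType.Exports.

Local Open Scope classical_set_scope.
Local Open Scope ring_scope.

(* [Quat w x y z] is w + x i + y j + z k. *)
Record quat (R : Type) := Quat { q_re : R; q_i : R; q_j : R; q_k : R }.

Section QuatAlgebra.
Variable R : realType.
Implicit Types p q r : quat R.

Definition quat_to_prod (T : Type) (q : quat T) :=
  (q_re q, q_i q, q_j q, q_k q).
Definition prod_to_quat (T : Type) (t : T * T * T * T) :=
  Quat t.1.1.1 t.1.1.2 t.1.2 t.2.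
Lemma quat_to_prodK (T : Type) :
  cancel (@quat_to_prod T) (@prod_to_quat T).
Proof. by case. Qed.
HB.instance Definition _ :=
  Choice.copy (quat R) (can_type (@quat_to_prodK R)).

Lemma quat_ext p q : q_re p = q_re q -> q_i p = q_i q -> q_j p = q_j q ->
  q_k p = q_k q -> p = q.
Proof. by case: p => ? ? ? ?; case: q => ? ? ? ? /= -> -> -> ->. Qed.

Definition addqt p q :=
  Quat (q_re p + q_re q) (q_i p + q_i q) (q_j p + q_j q) (q_k p + q_k q).
Definition oppqt p := Quat (- q_re p) (- q_i p) (- q_j p) (- q_k p).
Definition scaleqt (c : R) p :=
  Quat (c * q_re p) (c * q_i p) (c * q_j p) (c * q_k p).
Definition mulqt p q := Quat
  (q_re p * q_re q - q_i p * q_i q - q_j p * q_j q - q_k p * q_k q)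
  (q_re p * q_i q + q_i p * q_re q + q_j p * q_k q - q_k p * q_j q)
  (q_re p * q_j q - q_i p * q_k q + q_j p * q_re q + q_k p * q_i q)
  (q_re p * q_k q + q_i p * q_j q - q_j p * q_i q + q_k p * q_re q).
Definition conjqt p := Quat (q_re p) (- q_i p) (- q_j p) (- q_k p).

Fact addqtA : associative addqt.
Proof. by move=> p q r; apply: quat_ext; rewrite /= addrA. Qed.
Fact addqtC : commutative addqt.
Proof. by move=> p q; apply: quat_ext; rewrite /= addrC. Qed.
Fact add0qt : left_id (Quat 0 0 0 0) addqt.
Proof. by move=> p; apply: quat_ext; rewrite /= add0r. Qed.
Fact addNqt : left_inverse (Quat 0 0 0 0) oppqt addqt.
Proof. by move=> p; apply: quat_ext; rewrite /= addNr. Qed.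
HB.instance Definition _ :=
  GRing.isZmodule.Build (quat R) addqtA addqtC add0qt addNqt.

Fact mulqtA : associative mulqt.
Proof. by move=> p q r; apply: quat_ext => /=; ring. Qed.
Fact mul1qt : left_id (Quat 1 0 0 0) mulqt.
Proof. by move=> p; apply: quat_ext => /=; ring. Qed.
Fact mulqt1 : right_id (Quat 1 0 0 0) mulqt.
Proof. by move=> p; apply: quat_ext => /=; ring. Qed.
Fact mulqtDl : left_distributive mulqt +%R.
Proof. by move=> p q r; apply: quat_ext => /=; ring. Qed.
Fact mulqtDr : right_distributive mulqt +%R.
Proof. by move=> p q r; apply: quat_ext => /=; ring. Qed.
Fact oneqt_neq0 : Quat 1 0 0 0 != 0 :> quat R.
Proof. by apply/eqP => -[] /eqP; rewrite oner_eq0. Qed.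
HB.instance Definition _ :=
  GRing.Zmodule_isNzRing.Build (quat R) mulqtA mul1qt mulqt1 mulqtDl mulqtDr
    oneqt_neq0.

Fact scaleqtA c d p : scaleqt c (scaleqt d p) = scaleqt (c * d) p.
Proof. by apply: quat_ext; rewrite /= mulrA. Qed.
Fact scale1qt : left_id 1 scaleqt.
Proof. by move=> p; apply: quat_ext; rewrite /= mul1r. Qed.
Fact scaleqtDr : right_distributive scaleqt +%R.
Proof. by move=> c p q; apply: quat_ext; rewrite /= mulrDr. Qed.
Fact scaleqtDl p : {morph scaleqt^~ p : c d / c + d}.
Proof. by move=> c d; apply: quat_ext; rewrite /= mulrDl. Qed.
HB.instance Definition _ :=
  GRing.Zmodule_isLmodule.Build R (quat R) scaleqtA scale1qt scaleqtDr scaleqtDl.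

Fact scaleqtAl (c : R) p q : c *: (p * q) = (c *: p) * q.
Proof. by apply: quat_ext => /=; ring. Qed.
HB.instance Definition _ :=
  GRing.Lmodule_isLalgebra.Build R (quat R) scaleqtAl.
Fact scaleqtAr (c : R) p q : c *: (p * q) = p * (c *: q).
Proof. by apply: quat_ext => /=; ring. Qed.
HB.instance Definition _ := GRing.Lalgebra_isAlgebra.Build R (quat R) scaleqtAr.

(* |q| = sqrt (q * conj q); the product q * conj q is real. *)
Definition normqt q : R := Num.sqrt (q_re (q * conjqt q)).

Definition sqnqt q : R := q_re q ^+ 2 + q_i q ^+ 2 + q_j q ^+ 2 + q_k q ^+ 2.

Lemma mulqt_conj q : q * conjqt q = (sqnqt q)%:A.
Proof. by apply: quat_ext; rewrite /= /sqnqt; ring. Qed.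
Lemma mul_conjqt q : conjqt q * q = (sqnqt q)%:A.
Proof. by apply: quat_ext; rewrite /= /sqnqt; ring. Qed.
Lemma normqtE q : normqt q = Num.sqrt (sqnqt q).
Proof. by rewrite /normqt mulqt_conj /= mulr1. Qed.
Lemma sqnqt_ge0 q : 0 <= sqnqt q.
Proof. by rewrite !addr_ge0 ?sqr_ge0. Qed.
Lemma sqnqt_eq0 q : (sqnqt q == 0) = (q == 0).
Proof.
apply/eqP/eqP => [|->]; last by rewrite /sqnqt /= !expr0n /= !addr0.
rewrite /sqnqt => q0; have ge0 := @sqr_ge0 R.
move: (ge0 (q_re q)) (ge0 (q_i q)) (ge0 (q_j q)) (ge0 (q_k q)) => h1 h2 h3 h4.
by apply: quat_ext; apply/eqP; rewrite /= -sqrf_eq0; apply/eqP; lra.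
Qed.

Definition invqt q : quat R := (sqnqt q)^-1 *: conjqt q.
Fact mulVqt : {in [pred q : quat R | q != 0], left_inverse 1 invqt *%R}.
Proof.
by move=> q; rewrite inE -sqnqt_eq0 => q0; rewrite /invqt -scaleqtAl mul_conjqt
  scalerA mulVf // scale1r.
Qed.
Fact mulqtV : {in [pred q : quat R | q != 0], right_inverse 1 invqt *%R}.
Proof.
by move=> q; rewrite inE -sqnqt_eq0 => q0; rewrite /invqt -scalerAr mulqt_conj
  scalerA mulVf // scale1r.
Qed.
Fact unitqtP p q : q * p = 1 /\ p * q = 1 -> p != 0.
Proof. by case=> qp _; apply/eqP => p0; move/eqP: qp;
  rewrite p0 mulr0 eq_sym oner_eq0. Qed.
Fact invqt_out : {in [predC [pred q : quat R | q != 0]], invqt =1 id}.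
Proof.
move=> q; rewrite !inE negbK => /eqP ->.
by apply: quat_ext; rewrite /= ?oppr0 mulr0.
Qed.
HB.instance Definition _ :=
  GRing.NzRing_hasMulInverse.Build (quat R) mulVqt mulqtV unitqtP invqt_out.

Fact normqtD p q : normqt (p + q) <= normqt p + normqt q.
Proof.
rewrite !normqtE.
set u := Num.sqrt (sqnqt p); set v := Num.sqrt (sqnqt q).
have u0 : 0 <= u by exact: sqrtr_ge0.
have v0 : 0 <= v by exact: sqrtr_ge0.
have u2 : u ^+ 2 = sqnqt p by rewrite sqr_sqrtr ?sqnqt_ge0.
have v2 : v ^+ 2 = sqnqt q by rewrite sqr_sqrtr ?sqnqt_ge0.
rewrite -[leRHS]ger0_norm ?addr_ge0// -sqrtr_sqr ler_wsqrtr//.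
pose s := q_re p * q_re q + q_i p * q_i q + q_j p * q_j q + q_k p * q_k q.
have suv : s <= u * v.
  have [s0|s0] := leP s 0; first by rewrite (le_trans s0) ?mulr_ge0.
  rewrite -(@ler_pXn2r _ 2) ?nnegrE ?mulr_ge0 ?(ltW s0)//.
  rewrite exprMn u2 v2 -subr_ge0.
  have -> : sqnqt p * sqnqt q - s ^+ 2 =
    (q_re p * q_i q - q_i p * q_re q) ^+ 2 +
    (q_re p * q_j q - q_j p * q_re q) ^+ 2 +
    (q_re p * q_k q - q_k p * q_re q) ^+ 2 +
    (q_i p * q_j q - q_j p * q_i q) ^+ 2 +
    (q_i p * q_k q - q_k p * q_i q) ^+ 2 +
    (q_j p * q_k q - q_k p * q_j q) ^+ 2 by rewrite /sqnqt /s; ring.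
  by rewrite !addr_ge0 ?sqr_ge0.
have -> : sqnqt (p + q) = sqnqt p + sqnqt q + s *+ 2 by rewrite /sqnqt /s /=; ring.
by rewrite sqrrD u2 v2; lra.
Qed.
Fact normqtZ (c : R) q : normqt (c *: q) = `|c| * normqt q.
Proof.
rewrite !normqtE -sqrtr_sqr -sqrtrM ?sqr_ge0//; congr Num.sqrt.
by rewrite /sqnqt /=; ring.
Qed.
Fact normqt0_eq0 q : normqt q = 0 -> q = 0.
Proof.
rewrite normqtE => /eqP; rewrite sqrtr_eq0 => q0.
by apply/eqP; rewrite -sqnqt_eq0 eq_le q0 sqnqt_ge0.
Qed.
HB.instance Definition _ :=
  Lmodule_isNormed.Build R (quat R) normqtD normqtZ normqt0_eq0.

End QuatAlgebra.

Section SliceRegular.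
Variable R : realType.
Implicit Types (f g : quat R -> quat R) (q : quat R).

(* Functions on the open unit ball are represented by total functions
   [quat R -> quat R] whose values outside the ball are irrelevant. *)

Definition imag_units : set (quat R) := [set I | I ^+ 2 = -1].

Definition slice_point (I : quat R) (p : R * R) : quat R :=
  p.1%:A + p.2 *: I.

Definition slice_regular f :=
  forall I, imag_units I ->
  let fI := f \o slice_point I in
  forall p : R * R, `|slice_point I p| < 1 ->
  [/\ derivable fI p (1, 0) /\ derivable fI p (0, 1),
      {for p, continuous ('D_(1, 0) fI)},
      {for p, continuous ('D_(0, 1) fI)} &
      2^-1 *: ('D_(1, 0) fI p + I * 'D_(0, 1) fI p) = 0].

Definition pseries (a : nat -> quat R) q : nat -> quat R :=
  series (fun n => q ^+ n * a n).

Definition psum (a : nat -> quat R) q : quat R := limn (pseries a q).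

Definition expands f (a : nat -> quat R) :=
  forall q, `|q| < 1 -> pseries a q @ \oo --> f q.

(* The coefficients of the power series expansion of [f] on the unit ball:
   when an expansion exists it is unique (look at real [q]). *)
Definition coefs f : nat -> quat R :=
  xget (fun=> 0) [set a | expands f a].

Definition rmul f g : quat R -> quat R :=
  psum (fun n => \sum_(k < n.+1) coefs f k * coefs g (n - k)%N).

Definition rconj f : quat R -> quat R := psum (fun n => conjqt (coefs f n)).

Definition rsym f : quat R -> quat R := rmul f (rconj f).

(* The values of [rsym f] are pointwise inverted and multiplied; the ring
   inverse of a nonzero quaternion is its true inverse. *)
Definition rinv f : quat R -> quat R := fun q => (rsym f q)^-1 * rconj f q.

Definition blaschke (a : quat R) : quat R -> quat R :=
  rmul (rinv (fun q => 1 - q * conjqt a)) (fun q => q - a).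

(* [blaschke_prod a m] is the regular product of the Blaschke functions of
   a 1, ..., a (m + 1). *)
Fixpoint blaschke_prod (a : nat -> quat R) (m : nat) : quat R -> quat R :=
  if m is m'.+1 then rmul (blaschke_prod a m') (blaschke (a m.+1))
  else blaschke (a 1%N).

(* Sequences are indexed from 1: [a 0] is never used, and the value at index 0
   below is a dummy. *)
Definition malmquist_takenaka (a : nat -> quat R) (n : nat) :
    quat R -> quat R :=
  let kernel := rinv (fun q => 1 - q * conjqt (a n)) in
  let c := Num.sqrt (1 - `|a n| ^+ 2) in
  match n with
  | 0%N => fun=> 0
  | 1%N => fun q => c *: kernel q
  | m.+2 => fun q => c *: rmul (blaschke_prod a m) kernel q
  end.

Definition hardy2 f :=
  slice_regular f /\
  exists2 a, expands f a & cvgn (series (fun n => `|a n| ^+ 2 : R)).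

Definition hdot f g : quat R :=
  limn (series (fun n => conjqt (coefs g n) * coefs f n)).

Definition mt_proj (a : nat -> quat R) (n : nat) f : quat R -> quat R :=
  fun q => \sum_(1 <= k < n.+1)
    malmquist_takenaka a k q * hdot f (malmquist_takenaka a k).

End SliceRegular.

(* Main.v *)
Require Import Defs.
From mathcomp Require Import all_boot all_order all_algebra.
From mathcomp Require Import all_classical all_reals all_analysis.
From mathcomp Require Import ring lra complex.
Import Order.TTheory GRing.Theory Num.Theory.
Import numFieldNormedType.Exports.
Local Open Scope ring_scope.

(** The functions [Phi_k] have their coefficients in the slice of the points, and
    only their values on this slice enter; there the quaternions commute, and the
    system is the classical one: with [b_n z] the product over [k <= n] of
    [(z - a_k) / (1 - z * conj a_k)], a telescoping sum gives the reproducing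
    kernel of its span,
      [sum_(k <= n) Phi_k(z) * conj (Phi_k w)
         = (1 - b_n z * conj (b_n w)) / (1 - z * conj w)].
    At [z = a_l] with [l <= n] the factor [b_n z] vanishes, so the right-hand
    side is [1 / (1 - a_l * conj w)]. For real [w = t] both sides are power
    series in [t]; comparing coefficients turns the identity into
      [sum_(k <= n) Phi_k(a_l) * conj (phi_(k,m)) = a_l ^+ m]  for every [m],
    where [phi_(k,m)] is the [m]-th coefficient of [Phi_k]
    (malmquist_takenaka_reproducing). Multiplying on the right by the [m]-th
    coefficient of [f], which need not lie in the slice, and summing over [m]
    gives [P_n f (a_l)] on the left and [f (a_l)] on the right.

    The analysis behind this is that of absolutely summable coefficient
    sequences. Every function of the system has such coefficients, they are
    stable under the regular product (series_convol_cvg, by Cauchy products),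
    they are determined by the values at real points (pseries_real_inj), and at
    a point commuting with the left factor's coefficients the regular product
    is the product of the values (rmul_commE). They also make the inner products
    with [f] converge, as the coefficients of [f] are bounded. The regular
    reciprocal of [1 - q * conj b] is computed in wiener_szego for all
    quaternions [q] of the ball. *)

(** * Norm, limits and series of quaternions *)

Section QuaternionAnalysis.
Local Open Scope classical_set_scope.
Context {R : realType}.
Implicit Types (p q : quat R) (u v : nat -> quat R).

Lemma norm_quatE q : `|q| = Num.sqrt (sqnqt q).
Proof. exact: normqtE. Qed.

Lemma sqr_norm_quat q : `|q| ^+ 2 = sqnqt q.
Proof. by rewrite norm_quatE sqr_sqrtr ?sqnqt_ge0. Qed.

Lemma norm_quatM p q : `|p * q| = `|p| * `|q|.
Proof.
rewrite !norm_quatE -sqrtrM ?sqnqt_ge0//; congr Num.sqrt.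
by rewrite /sqnqt /=; ring.
Qed.

Lemma norm_quat1 : `|1 : quat R| = 1.
Proof. by rewrite norm_quatE /sqnqt /= !expr0n /= !addr0 expr1n sqrtr1. Qed.

Lemma norm_quatX q n : `|q ^+ n| = `|q| ^+ n.
Proof.
elim: n => [|n IH]; first by rewrite !expr0 norm_quat1.
by rewrite !exprS norm_quatM IH.
Qed.

Lemma conjqtK : involutive (@conjqt R).
Proof. by move=> q; apply: quat_ext; rewrite /= ?opprK. Qed.

Lemma conjqtD p q : conjqt (p + q) = conjqt p + conjqt q.
Proof. by apply: quat_ext; rewrite /= ?opprD. Qed.

Lemma conjqtB p q : conjqt (p - q) = conjqt p - conjqt q.
Proof. by apply: quat_ext; rewrite /= ?opprD. Qed.

Lemma conjqtZ (c : R) q : conjqt (c *: q) = c *: conjqt q.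
Proof. by apply: quat_ext; rewrite /= ?mulrN. Qed.

Lemma conjqt0 : conjqt (0 : quat R) = 0.
Proof. by apply: quat_ext; rewrite /= ?oppr0. Qed.

Lemma conjqt1 : conjqt (1 : quat R) = 1.
Proof. by apply: quat_ext; rewrite /= ?oppr0. Qed.

Lemma norm_conjqt q : `|conjqt q| = `|q|.
Proof. by rewrite !norm_quatE; congr Num.sqrt; rewrite /sqnqt /= !sqrrN. Qed.

Lemma add_conjqt q : q + conjqt q = (2 * q_re q)%:A.
Proof. by apply: quat_ext => /=; ring. Qed.

Lemma quat_bound_cvg {T : Type} {F : set_system T} {FF : Filter F}
    (s : T -> quat R) (l : quat R) (b : T -> R) :
  (forall t, `|s t - l| <= b t) -> b @ F --> (0 : R) -> s @ F --> l.
Proof.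
move=> sb b0; apply/cvgrPdist_lt => e e0.
move/cvgr0Pnorm_lt: b0 => /(_ _ e0); apply: filterS => t bt.
rewrite distrC; apply: le_lt_trans (sb t) _.
exact: le_lt_trans (ler_norm _) bt.
Qed.

Lemma quat_lip_cvg {T : Type} {F : set_system T} {FF : Filter F}
    (g : quat R -> quat R) (C : R) (s : T -> quat R) (l : quat R) :
  (forall p q, `|g p - g q| <= C * `|p - q|) ->
  s @ F --> l -> (g \o s) @ F --> g l.
Proof.
move=> gC sl; apply: (quat_bound_cvg _ _ (fun t => C * `|s t - l|)).
  by move=> t; exact: gC.
rewrite -[X in _ --> X](mulr0 C); apply: cvgMl_tmp.
have /cvg_norm : (s t - l) @[t --> F] --> (0 : quat R).
  by rewrite -(subrr l); apply: cvgB => //; exact: cvg_cst.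
by rewrite normr0.
Qed.

Lemma cvg_quatMl {T : Type} {F : set_system T} {FF : Filter F}
    c (s : T -> quat R) (l : quat R) :
  s @ F --> l -> (c * s t) @[t --> F] --> c * l.
Proof.
by apply: (quat_lip_cvg ( *%R c) `|c|) => p q; rewrite -mulrBr norm_quatM.
Qed.

Lemma cvg_quatMr {T : Type} {F : set_system T} {FF : Filter F}
    c (s : T -> quat R) (l : quat R) :
  s @ F --> l -> (s t * c) @[t --> F] --> l * c.
Proof.
apply: (quat_lip_cvg (fun x => x * c) `|c|) => p q.
by rewrite -mulrBl norm_quatM mulrC.
Qed.

Lemma cvg_conjqt {T : Type} {F : set_system T} {FF : Filter F}
    (s : T -> quat R) (l : quat R) :
  s @ F --> l -> conjqt (s t) @[t --> F] --> conjqt l.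
Proof.
apply: (quat_lip_cvg (@conjqt R) 1) => p q.
by rewrite -conjqtB norm_conjqt mul1r.
Qed.

Lemma cvg_quatM {T : Type} {F : set_system T} {FF : Filter F}
    (s t : T -> quat R) (l m : quat R) :
  s @ F --> l -> t @ F --> m -> (s x * t x) @[x --> F] --> l * m.
Proof.
move=> sl tm.
apply: (quat_bound_cvg _ _
  (fun x => `|s x - l| * `|t x| + `|l| * `|t x - m|)).
  move=> x; have -> : s x * t x - l * m = (s x - l) * t x + l * (t x - m).
    by rewrite mulrBl mulrBr addrA subrK.
  by rewrite (le_trans (ler_normD _ _))// !norm_quatM.
have dist0 (w : T -> quat R) k : w @ F --> k -> `|w x - k| @[x --> F] --> (0:R).
  move=> wk; have /cvg_norm : (w t - k) @[t --> F] --> (0 : quat R).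
    by rewrite -(subrr k); apply: cvgB => //; exact: cvg_cst.
  by rewrite normr0.
have -> : (0 : R) = 0 * `|m| + `|l| * 0 by rewrite mul0r mulr0 addr0.
apply: cvgD; last by apply: cvgMl_tmp; exact: dist0.
by apply: cvgM; [exact: dist0|exact: cvg_norm].
Qed.

Lemma cvg_sum_nat (s : nat -> nat -> quat R) (l : nat -> quat R) m n :
  (forall k, (m <= k)%N -> s k @ \oo --> l k) ->
  \sum_(m <= k < n) s k j @[j --> \oo] --> \sum_(m <= k < n) l k.
Proof.
move=> sl; have [mn|nm] := leqP m n; last first.
  rewrite big_geq ?(ltnW nm)//; under eq_fun do rewrite big_geq ?(ltnW nm)//.
  exact: cvg_cst.
rewrite -(subnKC mn); elim: (n - m)%N => [|d IH].
  rewrite addn0 big_geq//; under eq_fun do rewrite big_geq//.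
  exact: cvg_cst.
rewrite addnS big_nat_recr ?leq_addr//=.
under eq_fun do rewrite big_nat_recr ?leq_addr//=.
by apply: cvgD => //; apply: sl; exact: leq_addr.
Qed.

Definition abs_summable u := cvgn [normed series u].

Lemma summable_le u v : (forall n, `|u n| <= `|v n|) -> abs_summable v -> abs_summable u.
Proof. by move=> uv; apply: series_le_cvg => n //=. Qed.

(** The four real coordinates are dominated by the norm, so each coordinate
    series converges absolutely. *)
Lemma summable_cvg u : abs_summable u -> cvgn (series u).
Proof.
move=> us.
have comp (g : quat R -> R) : (forall q, `|g q| <= `|q|) ->
    cvgn (series (g \o u)).
  move=> gq; apply: normed_cvg.
  by apply: series_le_cvg us => n //=; exact: gq.
have bnd (x y : R) : x ^+ 2 <= y -> `|x| <= Num.sqrt y.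
  by move=> xy; rewrite -sqrtr_sqr ler_wsqrtr.
have ge0 := @sqr_ge0 R.
have /comp h1 q : `|q_re q| <= `|q|.
  rewrite norm_quatE bnd// /sqnqt; have := (ge0 (q_i q), ge0 (q_j q), ge0 (q_k q)).
  by case=> -[]; lra.
have /comp h2 q : `|q_i q| <= `|q|.
  rewrite norm_quatE bnd// /sqnqt; have := (ge0 (q_re q), ge0 (q_j q), ge0 (q_k q)).
  by case=> -[]; lra.
have /comp h3 q : `|q_j q| <= `|q|.
  rewrite norm_quatE bnd// /sqnqt; have := (ge0 (q_re q), ge0 (q_i q), ge0 (q_k q)).
  by case=> -[]; lra.
have /comp h4 q : `|q_k q| <= `|q|.
  rewrite norm_quatE bnd// /sqnqt; have := (ge0 (q_re q), ge0 (q_i q), ge0 (q_j q)).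
  by case=> -[]; lra.
have -> : series u = fun n =>
    series (@q_re R \o u) n *: Quat 1 0 0 0 + series (@q_i R \o u) n *: Quat 0 1 0 0
    + series (@q_j R \o u) n *: Quat 0 0 1 0 + series (@q_k R \o u) n *: Quat 0 0 0 1.
  apply/funext => n; elim: n => [|n IH].
    by rewrite /series /= !big_nil !scale0r !addr0.
  move: IH; rewrite /series /= !big_nat_recr //= => ->.
  by apply: quat_ext => /=; ring.
apply: is_cvgD; [apply: is_cvgD; [apply: is_cvgD|]|]; exact: is_cvgZr_tmp.
Qed.

End QuaternionAnalysis.

(** * Cauchy products *)

Section CauchyProduct.
Local Open Scope classical_set_scope.

(** Both sides sum [F k j] over the triangle [k + j < N], by antidiagonals and
    by rows. *)
Lemma sum_triangle (V : nmodType) (F : nat -> nat -> V) N :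
  \sum_(0 <= n < N) \sum_(k < n.+1) F k (n - k)%N =
  \sum_(0 <= k < N) \sum_(0 <= j < N - k) F k j.
Proof.
elim: N => [|N IH]; first by rewrite !big_nil.
rewrite !big_nat_recr//= IH subSnn big_nat1 big_ord_recr/= subnn addrA.
congr (_ + _); rewrite -(big_mkord xpredT (fun k => F k (N - k)%N)) -big_split/=.
by apply: eq_big_nat => k /andP[_ kN]; rewrite subSn ?(ltnW kN)// big_nat_recr.
Qed.

Lemma ler_sum_nat_wider (K : numDomainType) (x : nat -> K) m n :
  (forall k, 0 <= x k) -> (m <= n)%N ->
  \sum_(0 <= k < m) x k <= \sum_(0 <= k < n) x k.
Proof.
move=> x0 mn; rewrite [leRHS](@big_cat_nat _ _ _ m)//= lerDl.
by rewrite sumr_ge0.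
Qed.

Definition convol {S : pzSemiRingType} (u v : nat -> S) (n : nat) : S :=
  \sum_(k < n.+1) u k * v (n - k)%N.

(** The triangle of side [n] lies in the square of side [n], and the triangle of
    side [n + n] contains it; so the partial sums of the Cauchy product are
    squeezed between products of partial sums. *)
Lemma convol_cvg_ge0 (K : realType) (x y : nat -> K) :
  (forall n, 0 <= x n) -> (forall n, 0 <= y n) ->
  cvgn (series x) -> cvgn (series y) ->
  series (convol x y) @ \oo --> limn (series x) * limn (series y).
Proof.
move=> x0 y0 xs ys; set a := limn _; set b := limn (series y).
have xa n : series x n <= a.
  by apply: nondecreasing_cvgn_le => //; exact: nondecreasing_series.
have yb n : series y n <= b.
  by apply: nondecreasing_cvgn_le => //; exact: nondecreasing_series.
have sx0 n : 0 <= series x n by rewrite sumr_ge0.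
have sy0 n : 0 <= series y n by rewrite sumr_ge0.
have w0 n : 0 <= convol x y n by rewrite sumr_ge0// => k _; rewrite mulr_ge0.
have triE n : series (convol x y) n =
    \sum_(0 <= k < n) \sum_(0 <= j < n - k) x k * y j.
  exact: (sum_triangle _ (fun k j => x k * y j)).
have sqE n : series x n * series y n =
    \sum_(0 <= k < n) \sum_(0 <= j < n) x k * y j.
  by rewrite /series /= mulr_suml; apply: eq_bigr => k _; rewrite mulr_sumr.
have wub n : series (convol x y) n <= a * b.
  apply: le_trans (ler_pM (sx0 n) (sy0 n) (xa n) (yb n)).
  rewrite triE sqE; apply: ler_sum => k _.
  by apply: ler_sum_nat_wider => [j|]; rewrite ?mulr_ge0 ?leq_subr.
have wlb n : series x n * series y n <= series (convol x y) (n + n).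
  rewrite sqE triE.
  apply: (@le_trans _ _ (\sum_(0 <= k < n) \sum_(0 <= j < n + n - k) x k * y j)).
    rewrite !big_nat; apply: ler_sum => k /andP[_ kn].
    apply: ler_sum_nat_wider => [j|]; first by rewrite mulr_ge0.
    by rewrite -addnBA ?leq_addr// ltnW.
  apply: ler_sum_nat_wider; last exact: leq_addr.
  by move=> k; rewrite sumr_ge0// => j _; rewrite mulr_ge0.
have wc : cvgn (series (convol x y)).
  apply: nondecreasing_is_cvgn; first exact: nondecreasing_series.
  by exists (a * b) => _ [n _ <-].
suff -> : a * b = limn (series (convol x y)) by [].
apply/eqP; rewrite eq_le; apply/andP; split; last first.
  by apply: limr_le => //; exact: nearW.
have xyab : series x n * series y n @[n --> \oo] --> a * b by exact: cvgM xs ys.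
apply: (cvgr_to_le xyab).
apply: nearW => n; apply: le_trans (wlb n) _.
by apply: nondecreasing_cvgn_le => //; exact: nondecreasing_series.
Qed.

Context {R : realType}.
Implicit Types u v : nat -> quat R.

Lemma norm_convol u v n :
  `|convol u v n| <= convol (fun k => `|u k|) (fun k => `|v k|) n.
Proof.
apply: le_trans (ler_norm_sum _ _ _) _.
by apply: ler_sum => k _; rewrite norm_quatM.
Qed.

Lemma summable_convol u v : abs_summable u -> abs_summable v -> abs_summable (convol u v).
Proof.
move=> us vs.
have := convol_cvg_ge0 _ _ _ (fun n => normr_ge0 (u n)) (fun n => normr_ge0 (v n)) us vs.
move=> /cvgP; apply: series_le_cvg => n //=; last exact: norm_convol.
by rewrite sumr_ge0// => k _; rewrite mulr_ge0.
Qed.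

(** The product of the partial sums exceeds the partial sum of the Cauchy product
    by the terms of the square outside the triangle. These are bounded by the
    same expression for the norms, which tends to 0 by the nonnegative case. *)
Lemma series_convol_cvg u v (a b : quat R) : abs_summable u -> abs_summable v ->
  series u @ \oo --> a -> series v @ \oo --> b ->
  series (convol u v) @ \oo --> a * b.
Proof.
move=> us vs ua vb.
have wc := convol_cvg_ge0 _ _ _ (fun n => normr_ge0 (u n)) (fun n => normr_ge0 (v n)) us vs.
set x := fun n => `|u n| in us wc; set y := fun n => `|v n| in vs wc.
suff d0 : series (convol u v) n - series u n * series v n @[n --> \oo] --> (0 : quat R).
  by apply: cvg_sub0 d0 _; exact: cvg_quatM.
apply: (quat_bound_cvg _ _ (fun n => series x n * series y n - series (convol x y) n)).
  move=> n; rewrite subr0 distrC.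
  have sqE (S : pzRingType) (w z : nat -> S) : series w n * series z n =
      \sum_(0 <= k < n) (\sum_(0 <= j < n - k) w k * z j
                       + \sum_(n - k <= j < n) w k * z j).
    rewrite /series /= mulr_suml; apply: eq_bigr => k _; rewrite mulr_sumr.
    by rewrite -big_cat_nat ?leq_subr.
  have defE (S : pzRingType) (w z : nat -> S) :
      series w n * series z n - series (convol w z) n =
      \sum_(0 <= k < n) \sum_(n - k <= j < n) w k * z j.
    rewrite sqE {1}/series /= (sum_triangle _ (fun k j => w k * z j)).
    by rewrite -sumrB; apply: eq_bigr => k _; rewrite addrAC subrr add0r.
  rewrite !defE; apply: le_trans (ler_norm_sum _ _ _) _; apply: ler_sum => k _.
  apply: le_trans (ler_norm_sum _ _ _) _; apply: ler_sum => j _.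
  by rewrite norm_quatM.
by rewrite -(subrr (limn (series x) * limn (series y))); apply: cvgB => //; exact: cvgM.
Qed.

End CauchyProduct.

(** * Power series and the regular product *)

Section PowerSeries.
Local Open Scope classical_set_scope.
Context {R : realType}.
Implicit Types (p q : quat R) (a b d u : nat -> quat R) (f g : quat R -> quat R).

Lemma expr_scale1 (t : R) n : (t%:A : quat R) ^+ n = (t ^+ n)%:A.
Proof. by rewrite exprZn expr1n. Qed.

Lemma real_series_shift (t : R) d N :
  series (fun n => t ^+ n *: d n) N.+1 =
  d 0%N + t *: series (fun n => t ^+ n *: d n.+1) N.
Proof.
rewrite /series /= big_nat_recl// expr0 scale1r; congr (_ + _).
by rewrite scaler_sumr; apply: eq_bigr => k _; rewrite scalerA -exprS.
Qed.

(** The terms at [t = 1 / 2] are bounded by some [M], so the tail of the series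
    at [t <= 1 / 4] is at most [4 * M * t]; hence so is the norm of [d 0], and
    [t] can be taken arbitrarily small. *)
Lemma real_series_head0 d :
  (forall t : R, 0 < t < 1 -> series (fun n => t ^+ n *: d n) @ \oo --> (0 : quat R)) ->
  d 0%N = 0.
Proof.
move=> ser0.
have [M M0 dM] : exists2 M : R, 0 < M & forall n, `|2^-1 ^+ n *: d n| <= M.
  have h : 0 < (2^-1 : R) < 1 by lra.
  have /cvg_series_cvg_0 /cvg_norm /cvgP /cvg_has_ub [M Mub] := cvgP _ (ser0 _ h).
  exists (`|M| + 1) => [|n]; first by rewrite ltr_wpDl.
  apply: (@le_trans _ _ M); last by rewrite (le_trans (ler_norm M))// lerDl.
  by apply: Mub; exists n => //; rewrite normr_id.
have half n : \sum_(0 <= k < n) (2^-1 : R) ^+ k = 2 - 2 * 2^-1 ^+ n.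
  elim: n => [|n IH]; first by rewrite big_nil expr0; lra.
  by rewrite big_nat_recr//= IH exprS; lra.
have key (t : R) : 0 < t -> t <= 4^-1 -> `|d 0%N| <= 4 * M * t.
  move=> t0 t4; have h : 0 < t < 1 by lra.
  have := ser0 _ h; rewrite -cvg_shiftS => /cvg_norm; rewrite normr0 => lim0.
  apply/ler_addgt0Pr => e e0.
  have [N _ /(_ N (leqnn N))/=] := cvgr_lt _ lim0 _ e0.
  rewrite real_series_shift => small.
  have tail : `|t *: series (fun n => t ^+ n *: d n.+1) N| <= 4 * M * t.
    rewrite normrZ gtr0_norm// mulrC ler_pM2r//.
    rewrite /series /=; apply: le_trans (ler_norm_sum _ _ _) _.
    apply: (@le_trans _ _ (\sum_(0 <= k < N) 2 * M * 2^-1 ^+ k)); last first.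
      by rewrite -mulr_sumr half; have := exprn_ge0 N (_ : 0 <= 2^-1 :> R); nra.
    apply: ler_sum => k _.
    have := dM k.+1; rewrite !normrZ !normrX !gtr0_norm ?invr_gt0//.
    rewrite exprS -mulrA => dk.
    apply: (@le_trans _ _ ((4^-1) ^+ k * `|d k.+1|)).
      by rewrite ler_wpM2r// lerXn2r ?nnegrE; lra.
    have -> : 4^-1 = 2^-1 * 2^-1 :> R by lra.
    rewrite exprMn; have : 0 <= 2^-1 ^+ k :> R by rewrite exprn_ge0.
    by move: (2^-1 ^+ k) dk => h2 dk h20; nra.
  rewrite addrC -[leLHS](addrK `|t *: series (fun n => t ^+ n *: d n.+1) N|).
  rewrite lerBlDr.
  have := ler_normB (d 0%N + t *: series (fun n => t ^+ n *: d n.+1) N)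
                    (t *: series (fun n => t ^+ n *: d n.+1) N).
  by rewrite addrK; lra.
(* If [d 0] had norm [e > 0], the bound would fail at [e / (4 * e + 8 * M)]. *)
apply/eqP; rewrite -normr_eq0; apply: contraT => d0.
have {d0} e0 : 0 < `|d 0%N| by rewrite lt_def d0 normr_ge0.
move: e0 key; set e := `|d 0%N| => e0 key.
have D0 : 0 < 4 * e + 8 * M by lra.
have := key (e / (4 * e + 8 * M)); rewrite divr_gt0// => /(_ isT).
have -> : e / (4 * e + 8 * M) <= 4^-1 by rewrite ler_pdivrMr//; lra.
move=> /(_ isT); rewrite mulrA ler_pdivlMr//; nra.
Qed.

(** Dividing by [t] shifts the sequence, which reduces every coefficient to the
    head of a shifted sequence. *)
Lemma real_series0 d :
  (forall t : R, 0 < t < 1 -> series (fun n => t ^+ n *: d n) @ \oo --> (0 : quat R)) ->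
  forall n, d n = 0.
Proof.
move=> ser0 n; elim: n d ser0 => [|n IH] d ser0; first exact: real_series_head0.
apply: (IH (fun k => d k.+1)) => t t01; have t0 : t != 0 by apply/eqP; lra.
have -> : series (fun k => t ^+ k *: d k.+1) =
    fun N => t^-1 *: series (fun k => t ^+ k *: d k) N.+1.
  apply/funext => N; rewrite real_series_shift (real_series_head0 _ ser0) add0r.
  by rewrite scalerA mulVf// scale1r.
rewrite -(scaler0 _ t^-1); apply: cvgZl_tmp.
by have := ser0 _ t01; rewrite -cvg_shiftS.
Qed.

Lemma pseries_real_inj a b (l : R -> quat R) :
  (forall t : R, 0 < t < 1 -> Defs.pseries a t%:A @ \oo --> l t) ->
  (forall t : R, 0 < t < 1 -> Defs.pseries b t%:A @ \oo --> l t) -> a = b.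
Proof.
move=> al bl; apply/funext => n; apply/eqP; rewrite -subr_eq0; apply/eqP.
apply: (real_series0 (fun k => a k - b k)) => t t01.
rewrite -(subrr (l t)).
have -> : series (fun k => t ^+ k *: (a k - b k)) =
    fun N => Defs.pseries a t%:A N - Defs.pseries b t%:A N.
  apply/funext => N; rewrite /Defs.pseries /series /= -sumrB; apply: eq_bigr => k _.
  by rewrite expr_scale1 !mulr_algl scalerBr.
by apply: cvgB; [exact: al|exact: bl].
Qed.

Lemma real_in_ball (t : R) : 0 < t < 1 -> `|t%:A : quat R| < 1.
Proof. by move=> /andP[t0 t1]; rewrite normrZ norm_quat1 mulr1 gtr0_norm. Qed.

Lemma coefs_expands f a : expands f a -> coefs f = a.
Proof.
move=> fa; apply: xget_unique => // b fb.
by apply: (@pseries_real_inj b a (fun t => f t%:A)) => t /real_in_ball t1;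
  [exact: fb|exact: fa].
Qed.

(** Membership in the Wiener algebra, with the coefficients made explicit.
    Expansions on the open ball alone would not suffice: the inner products use
    the coefficients at radius 1. *)
Definition wiener f a := expands f a /\ abs_summable a.

Lemma summable_pseries a q : `|q| < 1 -> abs_summable a ->
  abs_summable (fun n => q ^+ n * a n).
Proof.
move=> q1; apply: summable_le => n; rewrite norm_quatM norm_quatX.
by rewrite ler_piMl// exprn_ile1// ltW.
Qed.

Lemma wiener_psum a : abs_summable a -> wiener (psum a) a.
Proof. by move=> sa; split=> // q q1; apply: summable_cvg (summable_pseries _ _ q1 sa). Qed.

Lemma wiener_rmul f g a b :
  wiener f a -> wiener g b -> wiener (rmul f g) (convol a b).
Proof.
move=> [fa sa] [gb sb]; rewrite /rmul (coefs_expands _ _ fa) (coefs_expands _ _ gb).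
by apply: wiener_psum; exact: summable_convol.
Qed.

Lemma wienerZ (c : R) f a :
  wiener f a -> wiener (fun q => c *: f q) (fun n => c *: a n).
Proof.
move=> [fa sa]; split=> [q q1|].
  have -> : Defs.pseries (fun n => c *: a n) q = c \*: Defs.pseries a q.
    apply/funext => N; rewrite /Defs.pseries /series /= scaler_sumr.
    by apply: eq_bigr => k _; rewrite scalerAr.
  by apply: cvgZl_tmp; exact: fa.
rewrite /abs_summable; have -> : [normed series (fun n => c *: a n)] = `|c| \*: [normed series a].
  apply/funext => N; rewrite /series /= scaler_sumr.
  by apply: eq_bigr => k _; rewrite normrZ.
exact: is_cvgZl_tmp.
Qed.

(** The power [q ^+ n] splits into [q ^+ k] and [q ^+ (n - k)], and the second
    factor can be moved past [a k] to stand before [b (n - k)]. *)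
Lemma rmul_commE f g a b q : wiener f a -> wiener g b ->
  (forall n, GRing.comm q (a n)) -> `|q| < 1 -> rmul f g q = f q * g q.
Proof.
move=> fa gb qa q1; have [fgab _] := wiener_rmul _ _ _ _ fa gb.
have [[fa' sa] [gb' sb]] := (fa, gb).
apply: (cvg_unique _ (fgab q q1)) => //.
have -> : Defs.pseries (convol a b) q =
    series (convol (fun n => q ^+ n * a n) (fun n => q ^+ n * b n)).
  apply/funext => N; apply: eq_bigr => n _; rewrite mulr_sumr.
  apply: eq_bigr => k _.
  have qak : a k * q ^+ (n - k) = q ^+ (n - k) * a k.
    exact: commrX (commr_sym (qa k)).
  rewrite -[RHS]mulrA (mulrA (a k)) qak !mulrA -exprD subnKC//.
  by rewrite -ltnS.
by apply: series_convol_cvg; [exact: summable_pseries|exact: summable_pseries|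
  exact: fa'|exact: gb'].
Qed.

End PowerSeries.

(** * The regular reciprocal of a linear polynomial *)

Section Kernel.
Local Open Scope classical_set_scope.
Context {R : realType}.
Implicit Types (p q b : quat R) (u : nat -> quat R).

Lemma series_finite_cvg u N : (forall n, (N <= n)%N -> u n = 0) ->
  series u @ \oo --> \sum_(0 <= k < N) u k.
Proof.
move=> u0; apply: cvg_near_cst; exists N => // n /= Nn.
rewrite /series /= (big_cat_nat (leq0n N) Nn)//= [X in _ + X]big_nat [X in _ + X]big1 ?addr0//.
by move=> k /andP[Nk _]; exact: u0.
Qed.

Lemma finite_abs_summable u N : (forall n, (N <= n)%N -> u n = 0) -> abs_summable u.
Proof.
move=> u0; apply/cvg_ex; exists (\sum_(0 <= k < N) `|u k|).
apply: cvg_near_cst; exists N => // n /= Nn.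
rewrite /series /= (big_cat_nat (leq0n N) Nn)//= [X in _ + X]big_nat [X in _ + X]big1 ?addr0//.
by move=> k /andP[Nk _]; rewrite u0// normr0.
Qed.

Definition linear_coefs (c0 c1 : quat R) (n : nat) : quat R :=
  match n with 0%N => c0 | 1%N => c1 | _ => 0 end.

Lemma wiener_linear (c0 c1 : quat R) :
  wiener (fun q => c0 + q * c1) (linear_coefs c0 c1).
Proof.
split; last by apply: (@finite_abs_summable _ 2) => -[|[|]].
move=> q _; have := @series_finite_cvg (fun n => q ^+ n * linear_coefs c0 c1 n) 2.
rewrite !big_nat_recr//= big_nil add0r expr0 mul1r expr1; apply.
by case=> [|[|]]//= n _; rewrite mulr0.
Qed.

Lemma norm_conj_lt1 b : `|b| < 1 -> `|conjqt b| < 1.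
Proof. by rewrite norm_conjqt. Qed.

Lemma abs_summable_geometric b : `|b| < 1 -> abs_summable (fun n => b ^+ n).
Proof.
move=> b1; rewrite /abs_summable.
have -> : [normed series (fun n => b ^+ n)] = series (geometric 1 `|b|).
  by apply/funext => N; apply: eq_bigr => k _; rewrite /= mul1r norm_quatX.
by have := @is_cvg_geometric_series R 1 `|b|; rewrite normr_id; exact.
Qed.

(** The equation is the linear substitute, valid without commutation, for the
    closed form of the geometric series. *)
Lemma geometric_pseries_rec (c q S : quat R) :
  Defs.pseries (fun n => c ^+ n) q @ \oo --> S -> S = 1 + q * S * c.
Proof.
move=> SE.
have tailE : (fun n => Defs.pseries (fun n => c ^+ n) q n.+1) =
    (fun n => 1 + q * Defs.pseries (fun n => c ^+ n) q n * c).
  apply/funext => n; rewrite /Defs.pseries /series /= big_nat_recl// !expr0 mul1r.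
  congr (_ + _); rewrite mulr_sumr mulr_suml; apply: eq_bigr => k _.
  by rewrite exprS exprSr !mulrA.
have SN : 1 + q * Defs.pseries (fun n => c ^+ n) q n * c @[n --> \oo] --> S.
  by rewrite -tailE cvg_shiftS.
have SR : 1 + q * Defs.pseries (fun n => c ^+ n) q n * c @[n --> \oo]
    --> 1 + q * S * c.
  apply: cvgD; first exact: cvg_cst.
  by apply: cvg_quatMr; exact: cvg_quatMl.
exact: (cvg_unique (@norm_hausdorff R (quat R)) SN SR).
Qed.

(** The symmetrization of [1 - q * conj b] has the real coefficients [1],
    [- 2 * q_re b] and [sqnqt b]. These are central, so its value [T] at [q]
    can be multiplied with [S], the sum of [q ^+ n * conj b ^+ n], using only
    [S = 1 + q * S * conj b]; the result is the value [1 - q * b] of the regular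
    conjugate. As this is nonzero on the ball, so is [T], and [S] is the value of
    the reciprocal. *)
Lemma wiener_szego b : `|b| < 1 ->
  wiener (rinv (fun q => 1 - q * conjqt b)) (fun n => conjqt b ^+ n).
Proof.
move=> b1.
have sg := abs_summable_geometric _ (norm_conj_lt1 _ b1).
split=> // q q1; rewrite /rinv.
set f := fun q => _; set c := conjqt b in sg f *.
have [fE sf] : wiener f (linear_coefs 1 (- c)).
  rewrite (_ : f = fun q => 1 + q * - c); first exact: wiener_linear.
  by apply/funext => p; rewrite mulrN.
have cf := coefs_expands _ _ fE.
have cc : (fun n => conjqt (coefs f n)) = linear_coefs 1 (- b).
  rewrite cf; apply/funext => -[|[|n]] /=; rewrite ?conjqt1 ?conjqt0//.
  by rewrite -(sub0r c) conjqtB conjqt0 conjqtK sub0r.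
have [fcE sfc] : wiener (rconj f) (linear_coefs 1 (- b)).
  by rewrite /rconj cc; apply: wiener_psum; exact: (wiener_linear _ _).2.
have fcq : rconj f q = 1 - q * b.
  apply: (cvg_unique _ (fcE q q1)) => //.
  by rewrite -mulrN; exact: (wiener_linear _ _).1.
pose m := (sqnqt b)%:A : quat R; pose r := (2 * q_re b)%:A : quat R.
have rE : r = b + c by rewrite /r -add_conjqt.
have mE : m = c * b by rewrite /m -mul_conjqt.
have fsq : rsym f q = 1 - q * r + q * q * m.
  have [fsE _] := wiener_rmul _ _ _ _ (conj fE sf) (conj fcE sfc).
  apply: (cvg_unique _ (fsE q q1)) => //.
  have := @series_finite_cvg
    (fun n => q ^+ n * convol (linear_coefs 1 (- c)) (linear_coefs 1 (- b)) n) 3.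
  rewrite !big_nat_recr//= big_nil add0r expr0 mul1r expr1.
  rewrite /convol !big_ord_recr !big_ord0 /= !(add0r, mul1r, mulr1, mul0r, mulr0, addr0).
  rewrite -opprD mulrN -rE mulrNN -mE expr2; apply=> n n3.
  rewrite big1 ?mulr0// => -[k kn] _ /=.
  case: k kn => [|[|k]] kn /=; last by rewrite mul0r.
    by case: n n3 kn => [|[|[|n]]]//=; rewrite mulr0.
  by case: n n3 kn => [|[|[|n]]]//= _ _; rewrite mulr0.
set T := rsym f q in fsq *.
have [S SE] : exists S : quat R, Defs.pseries (fun n => c ^+ n) q @ \oo --> S.
  by exists (psum (fun n => c ^+ n) q); apply: (wiener_psum _ sg).1.
have Srec := geometric_pseries_rec _ _ _ SE.
have TS : T * S = 1 - q * b.
  have rS p : r * p = p * r by rewrite /r mulr_algl mulr_algr.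
  have mS p : m * p = p * m by rewrite /m mulr_algl mulr_algr.
  rewrite fsq mulrDl mulrBl mul1r -!mulrA rS mS rE mE.
  have qSc : q * (S * c) = S - 1 by rewrite {2}Srec mulrA addrC addKr.
  rewrite mulrDr mulrDr qSc (mulrA S) (mulrA q (S * c)) qSc.
  rewrite mulrBl mulrBr mul1r; set x := q * (S * b).
  by rewrite opprD opprB (addrCA S) subrKC (addrC (- x)) addrA subrK.
have T0 : T != 0.
  apply/eqP => T0; move: TS; rewrite T0 mul0r => /eqP.
  rewrite eq_sym subr_eq0 => /eqP /(congr1 (fun p => `|p|)).
  rewrite norm_quat1 norm_quatM => qb1.
  have := mulr_ilt1 (normr_ge0 q) (normr_ge0 b) q1 b1.
  by rewrite -qb1 ltxx.
by rewrite fcq -TS mulKr.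
Qed.

End Kernel.

(** * The telescoping identity for Blaschke products *)

Section Telescoping.
Context {F : fieldType}.
Implicit Types (al be : nat -> F) (z s : F).

Definition blaschke_value (al be : nat -> F) (z : F) (n : nat) : F :=
  \prod_(1 <= k < n.+1) ((z - al k) / (1 - z * be k)).

Lemma blaschke_valueS al be z n : blaschke_value al be z n.+1 =
  blaschke_value al be z n * ((z - al n.+1) / (1 - z * be n.+1)).
Proof. by rewrite /blaschke_value big_nat_recr. Qed.

Lemma blaschke_value_eq0 al be n l : (1 <= l <= n)%N ->
  blaschke_value al be (al l) n = 0.
Proof.
move=> /andP[l1 ln]; apply/eqP; rewrite prodf_seq_eq0; apply/hasP; exists l.
  by rewrite mem_index_iota l1 ltnS.
by rewrite /= subrr mul0r.
Qed.

(** The identity behind each step is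
      [(1 - z * b) * (1 - s * a) - (z - a) * (s - b) = (1 - a * b) * (1 - z * s)].
    The sequence [be] and the point [s] stand for the conjugates of [al] and of
    the second point, which makes the identity one of rational functions. *)
Lemma takenaka_telescoping al be z s n :
  (forall k, (1 <= k)%N -> 1 - z * be k != 0) ->
  (forall k, (1 <= k)%N -> 1 - s * al k != 0) ->
  (1 - z * s) * (\sum_(1 <= k < n.+1) (1 - al k * be k) *
    (blaschke_value al be z k.-1 / (1 - z * be k) *
     (blaschke_value be al s k.-1 / (1 - s * al k)))) =
  1 - blaschke_value al be z n * blaschke_value be al s n.
Proof.
move=> zb sa; elim: n => [|n IH].
  by rewrite /blaschke_value !big_geq// mulr0 mulr1 subrr.
rewrite big_nat_recr//= mulrDr IH !blaschke_valueS.
set x := blaschke_value al be z n; set y := blaschke_value be al s n.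
have := zb n.+1 isT; have := sa n.+1 isT.
move: (al n.+1) (be n.+1) => a b sa0 zb0.
by field; rewrite sa0 zb0.
Qed.

End Telescoping.

(** * The Malmquist-Takenaka system on a slice *)

Section Slice.
Local Open Scope classical_set_scope.
Local Open Scope complex_scope.
Context {R : realType}.
Variable I : quat R.
Hypothesis hI : imag_units I.
Implicit Types (z w : R[i]) (q : quat R) (f g : quat R -> quat R).

(** For an imaginary unit [I] this is a ring embedding of the complex numbers,
    with image the slice of [I]; values on the slice are computed in the field
    [R[i]] through it. *)
Definition slice_emb z : quat R := (complex.Re z)%:A + complex.Im z *: I.

(** The vector part of [I ^+ 2] is [2 * q_re I] times that of [I]; were
    [q_re I] nonzero, [I] would be real and [I ^+ 2] nonnegative. *)
Lemma imag_unit_re : q_re I = 0.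
Proof.
case: I hI => w x y z; rewrite /imag_units /= expr2 => -[] /= h1 h2 h3 h4.
apply: contrapT => /eqP w0.
have cancel2 t : w * t + t * w = 0 -> t = 0.
  by rewrite (mulrC t) -mulr2n => /eqP; rewrite mulrn_eq0/= mulf_eq0 (negPf w0) => /eqP.
have x0 : x = 0 by apply: cancel2; move: h2; rewrite oppr0; lra.
have y0 : y = 0 by apply: cancel2; move: h3; rewrite oppr0; lra.
have z0 : z = 0 by apply: cancel2; move: h4; rewrite oppr0; lra.
by move: h1; rewrite x0 y0 z0; have := sqr_ge0 w; nra.
Qed.

Lemma slice_emb1 : slice_emb 1 = 1.
Proof. by rewrite /slice_emb /= scale1r scale0r addr0. Qed.

Lemma slice_embD z w : slice_emb (z + w) = slice_emb z + slice_emb w.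
Proof.
by case: z => a b; case: w => c d; rewrite /slice_emb /= !scalerDl addrACA.
Qed.

Lemma slice_embN z : slice_emb (- z) = - slice_emb z.
Proof. by case: z => a b; rewrite /slice_emb /= !scaleNr opprD. Qed.

Lemma slice_embB z w : slice_emb (z - w) = slice_emb z - slice_emb w.
Proof. by rewrite slice_embD slice_embN. Qed.

Lemma slice_emb_real (t : R) : slice_emb t%:C = t%:A.
Proof. by rewrite /slice_emb /= scale0r addr0. Qed.

Lemma slice_embM z w : slice_emb (z * w) = slice_emb z * slice_emb w.
Proof.
case: z => a b; case: w => c d; rewrite /slice_emb /=.
rewrite mulrDl !mulrDr !mulr_algl mulr_algr -scalerAl -scalerAr -expr2 hI.
rewrite !scalerA scalerN !(scalerDl, scaleNr) -!addrA; congr (_ + _).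
by rewrite addrC -!addrA (mulrC b c).
Qed.

Lemma slice_emb_conj z : slice_emb (conjc z) = conjqt (slice_emb z).
Proof.
have I0 := imag_unit_re.
by case: z => a b; apply: quat_ext; rewrite /= ?I0; ring.
Qed.

Lemma slice_embV z : z != 0 -> slice_emb z^-1 = (slice_emb z)^-1.
Proof.
move=> z0; have zV : slice_emb z * slice_emb z^-1 = 1.
  by rewrite -slice_embM mulfV// slice_emb1.
rewrite -[LHS](mulKr (_ : slice_emb z \is a GRing.unit)) ?zV ?mulr1//.
apply/eqP => e0; move/eqP: zV; rewrite e0 mul0r eq_sym.
by rewrite oner_eq0.
Qed.

Lemma slice_emb_neq0 z : slice_emb z != 0 -> z != 0.
Proof. by apply: contra => /eqP ->; rewrite /slice_emb /= !scale0r addr0. Qed.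

Lemma slice_emb_comm z q : GRing.comm q I -> GRing.comm (slice_emb z) q.
Proof.
by move=> qI; rewrite /GRing.comm /slice_emb mulrDl mulrDr mulr_algl mulr_algr
  -scalerAl -scalerAr qI.
Qed.

Lemma slice_emb_commI z : GRing.comm (slice_emb z) I.
Proof. exact: slice_emb_comm. Qed.

Lemma polar_in_slice (r t : R) : exists z, r *: ((cos t)%:A + sin t *: I) = slice_emb z.
Proof.
exists ((r * cos t) +i* (r * sin t)).
by rewrite /slice_emb /= scalerDr !scalerA.
Qed.

(** The coefficients have to commute with [I] for the regular product to be
    multiplicative in [h], the function induced on the slice. *)
Definition slice_expands f (u : nat -> quat R) (h : R[i] -> R[i]) :=
  [/\ wiener f u, forall n, GRing.comm (u n) I &
      forall z, `|slice_emb z| < 1 -> f (slice_emb z) = slice_emb (h z)].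

Lemma slice_expands_rmul f g u v h k :
  slice_expands f u h -> slice_expands g v k ->
  slice_expands (rmul f g) (convol u v) (fun z => h z * k z).
Proof.
move=> [fu uI fh] [gv vI gk]; split.
- exact: wiener_rmul.
- move=> n; apply: commr_sym; apply: commr_sum => m _.
  by apply: commr_sym; apply: commr_sym; apply: commrM; exact: commr_sym.
- move=> z z1; rewrite (rmul_commE _ _ _ _ _ fu gv)// ?fh ?gk ?slice_embM// => n.
  exact: slice_emb_comm.
Qed.

Lemma szego_denominator_neq0 z w :
  `|slice_emb z| < 1 -> `|slice_emb w| < 1 -> 1 - z * w != 0.
Proof.
move=> z1 w1; apply: slice_emb_neq0; rewrite slice_embB slice_emb1 slice_embM.
rewrite subr_eq0; apply/eqP => /(congr1 (fun q => `|q|)).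
rewrite norm_quat1 norm_quatM => zw1.
have := mulr_ilt1 (normr_ge0 _) (normr_ge0 _) z1 w1.
by rewrite -zw1 ltxx.
Qed.

(** On the slice [z] commutes with [conj w], so the series becomes a geometric
    series in [z * conj w], evaluated at 1. *)
Lemma slice_expands_szego w : `|slice_emb w| < 1 ->
  slice_expands (rinv (fun q => 1 - q * conjqt (slice_emb w)))
    (fun n => conjqt (slice_emb w) ^+ n) (fun z => (1 - z * conjc w)^-1).
Proof.
move=> w1; have ww := wiener_szego _ w1; split=> //.
  move=> n; apply: commr_sym; apply: commrX; apply: commr_sym.
  by rewrite -slice_emb_conj; exact: slice_emb_commI.
move=> z z1; set c := conjqt (slice_emb w).
have wc1 : `|slice_emb (conjc w)| < 1 by rewrite slice_emb_conj norm_conjqt.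
have d0 := szego_denominator_neq0 _ _ z1 wc1.
have zc : GRing.comm (slice_emb z) c.
  by rewrite /c -slice_emb_conj; apply: slice_emb_comm; exact: slice_emb_commI.
rewrite slice_embV// slice_embB slice_emb1 slice_embM slice_emb_conj -/c.
set S := rinv _ _.
have zcS : Defs.pseries (fun n => (slice_emb z * c) ^+ n) 1 @ \oo --> S.
  rewrite (_ : Defs.pseries _ 1 = Defs.pseries (fun n => c ^+ n) (slice_emb z)).
    exact: ww.1.
  apply/funext => N; apply: eq_bigr => n _.
  by rewrite expr1n mul1r exprMn_comm.
have {zcS} := geometric_pseries_rec _ _ _ zcS; rewrite mul1r => Srec.
have S1 : S * (1 - slice_emb z * c) = 1.
  by rewrite mulrBr mulr1 {1}Srec addrK.
have u : 1 - slice_emb z * c \is a GRing.unit.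
  by apply/eqP => e0; move/eqP: S1; rewrite e0 mulr0 eq_sym oner_eq0.
by rewrite -[LHS](mulrK u) S1 mul1r.
Qed.

Lemma slice_expands_blaschke w : `|slice_emb w| < 1 ->
  exists u, slice_expands (blaschke (slice_emb w)) u
    (fun z => (z - w) / (1 - z * conjc w)).
Proof.
move=> w1; exists (convol (fun n => conjqt (slice_emb w) ^+ n)
                          (linear_coefs (- slice_emb w) 1)).
have -> : (fun z => (z - w) / (1 - z * conjc w)) =
    (fun z => (1 - z * conjc w)^-1 * (z - w)) by apply/funext => z; rewrite mulrC.
apply: slice_expands_rmul; first exact: slice_expands_szego.
split.
- rewrite (_ : (fun q => _) = fun q => - slice_emb w + q * 1).
    exact: wiener_linear.
  by apply/funext => q; rewrite mulr1 addrC.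
- case=> [|[|n]] /=; [|exact/commr_sym/commr1|exact/commr_sym/commr0].
  by rewrite -slice_embN; exact: slice_emb_commI.
- by move=> z _; rewrite slice_embB.
Qed.

Variables (a : nat -> quat R) (al : nat -> R[i]).
Hypothesis a_al : forall k, (1 <= k)%N -> a k = slice_emb (al k).
Hypothesis a_lt1 : forall k, (1 <= k)%N -> `|a k| < 1.

Let be k := conjc (al k).

Lemma slice_expands_blaschke_prod m : exists u,
  slice_expands (blaschke_prod a m) u (fun z => blaschke_value al be z m.+1).
Proof.
have bl k : (1 <= k)%N -> exists u, slice_expands (blaschke (a k)) u
    (fun z => (z - al k) / (1 - z * be k)).
  by move=> k1; rewrite a_al//; apply: slice_expands_blaschke; rewrite -a_al// a_lt1.
elim: m => [|m [u IH]].
  have [u ub] := bl 1%N isT; exists u => /=.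
  rewrite (_ : (fun z => _) = fun z => (z - al 1%N) / (1 - z * be 1%N))//.
  by apply/funext => z; rewrite /blaschke_value big_nat1.
have [v vb] := bl m.+2 isT; exists (convol u v).
rewrite (_ : (fun z => _) = fun z => blaschke_value al be z m.+1 *
    ((z - al m.+2) / (1 - z * be m.+2))).
  exact: slice_expands_rmul.
by apply/funext => z; rewrite blaschke_valueS.
Qed.

Lemma malmquist_takenaka_slice k : (1 <= k)%N -> exists u,
  wiener (malmquist_takenaka a k) u /\
  forall z, `|slice_emb z| < 1 -> malmquist_takenaka a k (slice_emb z) =
    Num.sqrt (1 - `|a k| ^+ 2) *:
      slice_emb (blaschke_value al be z k.-1 / (1 - z * be k)).
Proof.
have sz j : (1 <= j)%N -> slice_expands (rinv (fun q => 1 - q * conjqt (a j)))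
    (fun n => conjqt (a j) ^+ n) (fun z => (1 - z * be j)^-1).
  by move=> j1; rewrite a_al//; apply: slice_expands_szego; rewrite -a_al// a_lt1.
case: k => [//|[_|m _]] /=.
  have [w _ v] := sz 1%N isT; eexists; split; first exact: wienerZ w.
  by move=> z z1; rewrite v// /blaschke_value big_geq// mul1r.
have [u ub] := slice_expands_blaschke_prod m.
have [w _ v] := slice_expands_rmul _ _ _ _ _ _ ub (sz m.+2 isT).
eexists; split; first exact: wienerZ w.
by move=> z z1; rewrite v.
Qed.

Lemma norm_slice_emb z : (`|slice_emb z| ^+ 2)%:A = slice_emb (z * conjc z).
Proof. by rewrite sqr_norm_quat -mulqt_conj slice_embM slice_emb_conj. Qed.

(** Both sides are coefficients of power series in a real variable [t], with the
    same value [1 / (1 - t * a l)]: on the right this is the geometric series, on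
    the left it is the telescoping identity at the zero [a l] of the Blaschke
    product. *)
Lemma malmquist_takenaka_reproducing (phi : nat -> nat -> quat R) n l :
  (forall k, (1 <= k)%N -> wiener (malmquist_takenaka a k) (phi k)) ->
  (1 <= l <= n)%N -> forall m,
  \sum_(1 <= k < n.+1) malmquist_takenaka a k (a l) * conjqt (phi k m) = a l ^+ m.
Proof.
move=> phiE ln m; have l1 : (1 <= l)%N by case/andP: ln.
set Phi := malmquist_takenaka a.
have conj_al : conjqt (a l) = slice_emb (be l) by rewrite a_al// slice_emb_conj.
have be1 k : (1 <= k)%N -> `|slice_emb (be k)| < 1.
  by move=> k1; rewrite slice_emb_conj norm_conjqt -a_al// a_lt1.
(* The parameter [conj (a l)] gives the geometric series with ratio [a l]. *)
have [szE _ szv] := slice_expands_szego (be l) (be1 l l1).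
move: szE szv; rewrite -conj_al conjqtK => szE szv.
have beC k : conjc (be k) = al k by exact: conjcK.
rewrite beC in szv.
suff /(congr1 (fun u => u m)) :
  (fun m => \sum_(1 <= k < n.+1) Phi k (a l) * conjqt (phi k m)) =
  (fun m => a l ^+ m) by [].
apply: (pseries_real_inj _ _ (fun t => slice_emb (1 - t%:C * al l)^-1)) => t t01;
  last first.
  have t1 := real_in_ball _ t01; rewrite -slice_emb_real in t1 *.
  by rewrite -szv//; exact: szE.1.
have t1 := real_in_ball _ t01.
have limE : slice_emb (1 - t%:C * al l)^-1 =
    \sum_(1 <= k < n.+1) Phi k (a l) * conjqt (Phi k t%:A).
  rewrite -slice_emb_real in t1 *.
  have al1 : `|slice_emb (al l)| < 1 by rewrite -a_al// a_lt1.
  have termE k : (1 <= k)%N -> Phi k (a l) * conjqt (Phi k (slice_emb t%:C)) =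
      slice_emb ((1 - al k * be k) *
        (blaschke_value al be (al l) k.-1 / (1 - al l * be k) *
         (blaschke_value be al t%:C k.-1 / (1 - t%:C * al k)))).
    move=> k1; have [u [_ v]] := malmquist_takenaka_slice k k1.
    rewrite /Phi {1}(a_al l)// !v// conjqtZ -scalerAl -scalerAr scalerA -expr2.
    rewrite sqr_sqrtr ?subr_ge0 ?exprn_ile1 ?(ltW (a_lt1 _ k1))//.
    rewrite -slice_emb_conj -slice_embM -mulr_algl scalerBl scale1r.
    rewrite a_al// norm_slice_emb -{1}slice_emb1 -slice_embB -slice_embM.
    congr (slice_emb (_ * (_ * _))).
    have cM (x y : R[i]) : conjc (x * y) = conjc x * conjc y by exact: rmorphM.
    have cB (x y : R[i]) : conjc (x - y) = conjc x - conjc y by exact: rmorphB.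
    have ct : conjc t%:C = t%:C by exact: conjc_real.
    rewrite cM conjc_inv cB cM conjc1 ct beC; congr (_ / _).
    rewrite /blaschke_value (big_morph _ cM (conjc1 R)); apply: eq_bigr => j _.
    by rewrite cM conjc_inv !cB cM conjc1 ct beC.
  rewrite [RHS](_ : _ = slice_emb (\sum_(1 <= k < n.+1) (1 - al k * be k) *
        (blaschke_value al be (al l) k.-1 / (1 - al l * be k) *
         (blaschke_value be al t%:C k.-1 / (1 - t%:C * al k))))); last first.
    rewrite (big_morph _ slice_embD (_ : slice_emb 0 = 0)).
      by rewrite !big_nat; apply: eq_bigr => k /andP[k1 _]; exact: termE.
    by rewrite /slice_emb /= !scale0r addr0.
  congr slice_emb.
  have := takenaka_telescoping al be (al l) t%:C n.
  rewrite blaschke_value_eq0// mul0r subr0 => tel.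
  have d0 : 1 - al l * t%:C != 0 by exact: szego_denominator_neq0.
  apply: (mulfI d0); rewrite tel; last first.
  - by move=> k k1; apply: szego_denominator_neq0; rewrite -?a_al// a_lt1.
  - by move=> k k1; apply: szego_denominator_neq0 => //; exact: be1.
  by rewrite (mulrC t%:C) mulfV.
rewrite limE.
rewrite (_ : Defs.pseries _ _ = fun N =>
  \sum_(1 <= k < n.+1) Phi k (a l) * conjqt (Defs.pseries (phi k) t%:A N)).
  apply: cvg_sum_nat => k k1; apply: cvg_quatMl; apply: cvg_conjqt.
  by have [+ _] := phiE _ k1; exact.
apply/funext => N; rewrite /Defs.pseries /series /=.
under [LHS]eq_bigr do rewrite mulr_sumr.
rewrite exchange_big /=; apply: eq_bigr => k _.
rewrite (big_morph (@conjqt R) (@conjqtD R) (@conjqt0 R)) mulr_sumr.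
apply: eq_bigr => j _; rewrite expr_scale1 !mulr_algl conjqtZ scalerAr //.
Qed.

Lemma mt_proj_interpolates f n l : hardy2 f -> (1 <= l <= n)%N ->
  mt_proj a n f (a l) = f (a l).
Proof.
move=> [_ [c fc c2]] ln; have l1 : (1 <= l)%N by case/andP: ln.
have /choice [phi phiE] : forall k, exists u, (1 <= k)%N ->
    wiener (malmquist_takenaka a k) u.
  move=> k; have [->|k0] := eqVneq k 0%N; first by exists (fun=> 0).
  have [|u [uw _]] := malmquist_takenaka_slice k; first by rewrite lt0n.
  by exists u.
set Phi := malmquist_takenaka a.
have [M M0 cM] : exists2 M : R, 0 <= M & forall m, `|c m| <= M.
  have /cvg_series_cvg_0 /cvgP /cvg_has_ub [M Mub] := c2.
  exists (1 + `|M|) => [|m]; first by rewrite addr_ge0.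
  have : `|c m| ^+ 2 <= `|M|.
    apply: le_trans (ler_norm M); apply: Mub; exists m => //.
    by rewrite ger0_norm// exprn_ge0.
  have := normr_ge0 (c m); have := normr_ge0 M; nra.
have dotE k : (1 <= k)%N ->
    series (fun m => conjqt (phi k m) * c m) @ \oo --> hdot f (Phi k).
  move=> k1; rewrite /hdot (coefs_expands _ _ fc) (coefs_expands _ _ (phiE k k1).1).
  apply: summable_cvg; apply: (@series_le_cvg _ _ (fun m => M * `|phi k m|)) => [||m|].
  - by move=> m /=; exact: normr_ge0.
  - by move=> m; rewrite mulr_ge0.
  - rewrite /= norm_quatM norm_conjqt mulrC.
    by apply: ler_wpM2r.
  - exact: (@is_cvg_seriesZ _ (fun m => `|phi k m|) M (phiE k k1).2).
have lim1 : \sum_(1 <= k < n.+1) Phi k (a l) *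
      series (fun m => conjqt (phi k m) * c m) N @[N --> \oo] --> mt_proj a n f (a l).
  by apply: cvg_sum_nat => k k1; apply: cvg_quatMl; exact: dotE.
have lim2 := fc (a l) (a_lt1 _ l1).
apply: (cvg_unique (@norm_hausdorff R (quat R)) _ lim2).
rewrite (_ : Defs.pseries c (a l) = fun N => \sum_(1 <= k < n.+1) Phi k (a l) *
      series (fun m => conjqt (phi k m) * c m) N)//.
apply/funext => N; rewrite /Defs.pseries /series /=.
under [RHS]eq_bigr do rewrite mulr_sumr.
rewrite exchange_big /=; apply: eq_bigr => m _.
rewrite -(malmquist_takenaka_reproducing phi n l phiE ln m) mulr_suml.
by apply: eq_bigr => k _; rewrite mulrA.
Qed.

End Slice.

Theorem theorem5p1 (R : realType) (a : nat -> quat R) (I : quat R)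
    (hI : imag_units I)
    (ha : forall n : nat, (1 <= n)%N -> `|a n| < 1)
    (haI : forall n : nat, (1 <= n)%N -> exists theta : R,
      a n = `|a n| *: ((cos theta)%:A + sin theta *: I))
    (n : nat) (hn : (1 <= n)%N)
    (f : quat R -> quat R) (hf : hardy2 f)
    (l : nat) (hl : (1 <= l <= n)%N) :
  mt_proj a n f (a l) = f (a l).
Proof.
have /choice [al alE] : forall k, exists z, (1 <= k)%N -> a k = slice_emb I z.
  move=> k; have [->|k0] := eqVneq k 0%N; first by exists 0.
  have [t ->] := haI k ltac:(by rewrite lt0n).
  by have [z ->] := polar_in_slice I `|a k| t; exists z.
exact: (mt_proj_interpolates I hI a al alE ha f n l hf hl).
Qed.
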